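(* Let $\lambda:R^+\to\mathbf C^\times$ be a primitive linear character. Let $d:A\to R$ be an $R$-linear map satisfying: (C1) if $a\in A$ and $d(ab)=0$ for all $b\in A$ then $a=0$; (C2) $d(a+\varepsilon a^* )=0$ for all $a\in A$. Let $\mu:A^+\to\mathbf C^\times$ be defined by $\mu(a)=\lambda(d(a))$ for $a\in A$. Let $f:V\times V\to R$, $f(u,v)=d(h(u,v))$, which is a non-degenerate alternating $R$-bilinear form, so that the unitary group $\mathrm U_m(A)=G(h)\cap\mathrm{GL}_A(V)$ is a subgroup of the symplectic group $\mathrm{Sp}_{sm}(R)=G(f)\cap\mathrm{GL}_R(V)$. Then $\mu$ is primitive, in the sense that the kernel of $\mu$ contains no non-zero right ideals of $A$. Moreover, the restriction to $\mathrm U_m(A)$ of a Weil representation of $\mathrm{Sp}_{sm}(R)$ of type $\lambda$ is a Weil representation of $\mathrm U_m(A)$ of type $\mu$.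
   Context: Setting. $R$ is a finite commutative local principal ring of odd prime characteristic $p$. $A$ is an associative $R$-algebra with identity, free of finite rank $s$ as an $R$-module, with an involution $*$ fixing $R$ elementwise. $V$ is a non-zero free right $A$-module of finite rank $m$. $\varepsilon\in\{1,-1\}$ and $h:V\times V\to A$ is an $\varepsilon$-hermitian form: $h$ is bi-additive, $A$-linear in the second variable, and $h(v,u)=\varepsilon h(u,v)^*$ for all $u,v\in V$; $h$ is non-degenerate: $v\mapsto h(v,-)$ is an isomorphism of $V$ onto $V^*=\mathrm{Hom}_A(V,A)$, made a right $A$-module by $(\alpha a)(v)=a^*\alpha(v)$. A linear character $\lambda:R^+\to\mathbf C^\times$ is primitive if its kernel contains no non-zero ideal of $R$. For a bi-additive map $k:V\times V\to M$, with $V,M$ finite abelian groups of odd order: $G(k)=\{g\in\mathrm{Aut}(V): k(gu,gv)=k(u,v)\ \forall u,v\}$ (additive automorphisms); the Heisenberg group $H(k)$ is the set $M\times V$ with $(r,v)(r',w)=(r+r'+k(v,w),v+w)$, and $M$ is identified with the central subgroup $(M,0)$. $G(k)$ acts on $H(k)$ by ${}^g(r,v)=(r,gv)$. For a linear character $\theta:M\to\mathbf C^\times$, a Schrödinger representation of type $\theta$ is an irreducible complex representation $S:H(k)\to\mathrm{GL}(X)$ whose restriction to $M$ is scalar via $\theta$ and which is equivalent to $h\mapsto S({}^gh)$ for every $g\in G(k)$. For a subgroup $\Gamma\le G(k)$, a Weil representation of $\Gamma$ of type $\theta$ is a representation $W:\Gamma\to\mathrm{GL}(X)$ such that $W(g)S(z)W(g)^{-1}=S({}^gz)$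 for all $g\in \Gamma$, $z\in H(k)$, for some Schrödinger representation $S:H(k)\to \mathrm{GL}(X)$ of type $\theta$. Here Weil representations of $\mathrm{Sp}_{sm}(R)$ are relative to $H(f)$, those of $\mathrm U_m(A)$ relative to $H(h)$ (with $M=A^+$). *)

(* Defs.v *)
From HB Require Import structures.
From mathcomp Require Import all_boot all_order all_algebra all_fingroup.
From mathcomp Require Import mxrepresentation.

Set Implicit Arguments.
Unset Strict Implicit.
Unset Printing Implicit Defensive.

Import GRing.Theory.
Local Open Scope ring_scope.

(* Over a commutative ring the right ideals are exactly the ideals, so this
   single notion serves for both R and A. *)
Definition right_ideal (T : finNzRingType) (I : {set T}) : Prop :=
  [/\ 0 \in I, {in I &, forall x y, x + y \in I}
    & forall x t, x \in I -> x * t \in I].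

Definition maximal_ideal (R : finComNzRingType) (I : {set R}) : Prop :=
  [/\ right_ideal I, I != [set: R]
    & forall J : {set R}, right_ideal J -> I \subset J ->
        J = I \/ J = [set: R]].

Definition local_ring (R : finComNzRingType) : Prop :=
  exists! I : {set R}, maximal_ideal I.

Definition principal_ring (R : finComNzRingType) : Prop :=
  forall I : {set R}, right_ideal I ->
    exists x : R, I = [set x * y | y in [set: R]].

(* Values are automatically units: theta x * theta (- x) = 1. *)
Record lin_char (M : zmodType) (C : fieldType) := LinChar {
  lin_char_fun :> M -> C;
  lin_char0 : lin_char_fun 0 = 1;
  lin_charD : forall x y, lin_char_fun (x + y) = lin_char_fun x * lin_char_fun y
}.

Definition primitive (T : finNzRingType) (C : fieldType) (theta : lin_char T C)
    : Prop :=
  forall I : {set T}, right_ideal I -> (forall x, x \in I -> theta x = 1) ->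
    I = [set 0].

Record biadditive (V M : zmodType) := Biadditive {
  biadd_fun :> V -> V -> M;
  biaddDl : forall u v w, biadd_fun (u + v) w = biadd_fun u w + biadd_fun v w;
  biaddDr : forall u v w, biadd_fun u (v + w) = biadd_fun u v + biadd_fun u w
}.

Section Pushforward.

Variables (M N : zmodType) (d : {additive M -> N}).

Section LinChar.

Variables (C : fieldType) (lam : lin_char N C).

Definition lin_char_comp_fun (a : M) : C := lam (d a).

Fact lin_char_comp0 : lin_char_comp_fun 0 = 1.
Proof. by rewrite /lin_char_comp_fun raddf0 lin_char0. Qed.

Fact lin_char_compD x y :
  lin_char_comp_fun (x + y) = lin_char_comp_fun x * lin_char_comp_fun y.
Proof. by rewrite /lin_char_comp_fun raddfD lin_charD. Qed.

Definition lin_char_comp : lin_char M C := LinChar lin_char_comp0 lin_char_compD.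

End LinChar.

Section Biadditive.

Variables (V : zmodType) (h : biadditive V M).

Definition biadd_comp_fun (u v : V) : N := d (h u v).

Fact biadd_compDl u v w :
  biadd_comp_fun (u + v) w = biadd_comp_fun u w + biadd_comp_fun v w.
Proof. by rewrite /biadd_comp_fun biaddDl raddfD. Qed.

Fact biadd_compDr u v w :
  biadd_comp_fun u (v + w) = biadd_comp_fun u v + biadd_comp_fun u w.
Proof. by rewrite /biadd_comp_fun biaddDr raddfD. Qed.

Definition biadd_comp : biadditive V N := Biadditive biadd_compDl biadd_compDr.

End Biadditive.

End Pushforward.

(* [act u c] is the right scalar multiplication u.c of V by T. *)
Section RightModule.

Variables (T : finNzRingType) (V : finZmodType) (act : V -> T -> V).

Definition right_linear (alpha : V -> T) : Prop :=
  (forall u v, alpha (u + v) = alpha u + alpha v) /\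
  (forall u c, alpha (act u c) = alpha u * c).

(* v |-> k(v,-) is an isomorphism of V onto Hom_T(V,T), on which T acts by
   (alpha c)(v) = conj c * alpha v: it takes values in Hom_T(V,T), is T-linear
   (additivity being part of [biadditive]) and is bijective. *)
Definition nondegenerate_form (conj : T -> T) (k : biadditive V T) : Prop :=
  [/\ forall v, right_linear (k v),
      forall v c w, k (act v c) w = conj c * k v w
    & forall alpha : V -> T, right_linear alpha ->
        exists! v, forall w, k v w = alpha w].

Definition GL_set : {set {perm V}} :=
  [set g : {perm V} | [forall u, forall v, g (u + v) == g u + g v]
                   && [forall u, forall c, g (act u c) == act (g u) c]].

Fact GL_group_set : group_set GL_set.
Proof.
apply/group_setP; split=> [|g g'].
  rewrite inE; apply/andP; split; apply/'forall_forallP => u v;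
  by rewrite !perm1.
rewrite !inE => /andP[/'forall_'forall_eqP gD /'forall_'forall_eqP gZ].
case/andP=> /'forall_'forall_eqP g'D /'forall_'forall_eqP g'Z.
by apply/andP; split; apply/'forall_'forall_eqP => u v;
  rewrite !permM (gD, gZ) (g'D, g'Z).
Qed.

Canonical GL_group := Group GL_group_set.

End RightModule.

(* The underlying set does not depend on k, but k is kept as an argument so
   that the group law can be attached to [heis k]. *)
Definition heis (V M : finZmodType) (k : biadditive V M) : Type :=
  (M * V)%type.

HB.instance Definition _ (V M : finZmodType) (k : biadditive V M) :=
  Finite.copy (heis k) (M * V)%type.

Section Heisenberg.

Variables (V M : finZmodType) (k : biadditive V M).

Definition isometry_set : {set {perm V}} :=
  [set g : {perm V} | [forall u, forall v, g (u + v) == g u + g v]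
                   && [forall u, forall v, k (g u) (g v) == k u v]].

Fact isometry_group_set : group_set isometry_set.
Proof.
apply/group_setP; split=> [|g g'].
  rewrite inE; apply/andP; split; apply/'forall_forallP => u v;
  by rewrite !perm1.
rewrite !inE => /andP[/'forall_'forall_eqP gD /'forall_'forall_eqP gk].
case/andP=> /'forall_'forall_eqP g'D /'forall_'forall_eqP g'k.
apply/andP; split; apply/'forall_'forall_eqP => u v; rewrite !permM.
  by rewrite gD g'D.
by rewrite g'k gk.
Qed.

Canonical isometry_group := Group isometry_group_set.

Definition heis_mul (x y : heis k) : heis k :=
  (x.1 + y.1 + k x.2 y.2, x.2 + y.2).
Definition heis_one : heis k := (0, 0).
Definition heis_inv (x : heis k) : heis k := (- x.1 + k x.2 x.2, - x.2).

Fact biadd0l v : k 0 v = 0.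
Proof. by apply: (addrI (k 0 v)); rewrite -biaddDl !addr0. Qed.

Fact biaddNl u v : k (- u) v = - k u v.
Proof. by apply: (addrI (k u v)); rewrite -biaddDl !subrr biadd0l. Qed.

Fact heis_mulA : associative heis_mul.
Proof.
move=> x y z; rewrite /heis_mul /= biaddDl biaddDr !addrA; congr (_, _).
by rewrite [LHS](ACl (1*2*5*3*6*4)).
Qed.

Fact heis_mul1 : left_id heis_one heis_mul.
Proof. by case=> r v; rewrite /heis_mul /= biadd0l !add0r addr0. Qed.

Fact heis_mulV : left_inverse heis_one heis_inv heis_mul.
Proof.
case=> r v; rewrite /heis_mul /= biaddNl addNr; congr (_, _).
by rewrite [LHS](ACl (1*3*2*4)) /= addNr add0r subrr.
Qed.

HB.instance Definition _ :=
  Finite_isGroup.Build (heis k) heis_mulA heis_mul1 heis_mulV.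

Definition heis_act (g : {perm V}) (z : heis k) : heis k := (z.1, g z.2).

Fact heis_actM g : g \in isometry_set ->
  {morph heis_act g : x y / (x * y)%g}.
Proof.
rewrite inE => /andP[/'forall_'forall_eqP gD /'forall_'forall_eqP gk] x y.
by rewrite /heis_act [LHS]/= gD -gk.
Qed.

Variable C : fieldType.

Section Twist.

Variables (n : nat) (S : mx_representation C [set: heis k] n).
Variables (g : {perm V}) (Gg : g \in isometry_set).

Definition twist_mx (z : heis k) : 'M[C]_n := S (heis_act g z).

Fact twist_mx_repr : mx_repr [set: heis k] twist_mx.
Proof.
have act1 : heis_act g 1%g = 1%g.
  by apply: (mulgI (heis_act g 1%g)); rewrite -heis_actM // !mulg1.
split=> [|x y _ _]; first by rewrite /twist_mx act1 repr_mx1.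
by rewrite /twist_mx heis_actM // repr_mxM ?inE.
Qed.

Definition twist_repr := MxRepresentation twist_mx_repr.

End Twist.

Variable theta : lin_char M C.

Definition schrodinger n (S : mx_representation C [set: heis k] n) : Prop :=
  [/\ mx_irreducible S,
      forall r : M, S ((r, 0) : heis k) = (theta r)%:M
    & forall (g : {perm V}) (Gg : g \in isometry_set),
        mx_rsim S (twist_repr S Gg)].

(* The product of automorphisms is composition, g g' = g \o g', whereas the
   product of {perm V} is (g' * g)%g = g \o g'; hence the swap below. *)
Definition comp_repr (Gamma : {set {perm V}}) n (W : {perm V} -> 'M[C]_n)
    : Prop :=
  W 1%g = 1%:M /\ {in Gamma &, forall g g', W (g' * g)%g = W g *m W g'}.

(* Only the values of W on Gamma matter, so restriction to a subgroup keeps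
   the same function W. *)
Definition weil_rep (Gamma : {group {perm V}}) n (W : {perm V} -> 'M[C]_n)
    : Prop :=
  [/\ Gamma \subset isometry_set,
      comp_repr Gamma W
    & exists2 S : mx_representation C [set: heis k] n, schrodinger S &
        {in Gamma, forall g (z : heis k),
           W g *m S z *m invmx (W g) = S (heis_act g z)}].

End Heisenberg.

Section Unitary.

Variables (R : finComNzRingType) (A : finAlgType R) (V : finLmodType A^c).

(* A left module over the converse ring A^c is a right A-module. *)
Definition rscale (v : V) (a : A) : V := (a : A^c) *: v.

Definition rscaleR (v : V) (r : R) : V := rscale v r%:A.

(* The last clause is "* fixes R elementwise". *)
Definition involution (star : A -> A) : Prop :=
  [/\ forall a b, star (a + b) = star a + star b,
      forall a b, star (a * b) = star b * star a,
      forall a, star (star a) = a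
    & forall r : R, star r%:A = r%:A].

Definition hermitian_form (star : A -> A) (eps : R) (h : biadditive V A)
    : Prop :=
  (forall v, right_linear rscale (h v)) /\
  (forall u v, h v u = eps *: star (h u v)).

Definition alternating_bilinear (f : biadditive V R) : Prop :=
  [/\ forall u r v, f (rscaleR u r) v = r * f u v,
      forall u v r, f u (rscaleR v r) = r * f u v
    & forall v, f v v = 0].

Definition unitary_group (h : biadditive V A) : {group {perm V}} :=
  [group of isometry_set h :&: GL_set rscale].

Definition symplectic_group (f : biadditive V R) : {group {perm V}} :=
  [group of isometry_set f :&: GL_set rscaleR].

End Unitary.

(* Main.v *)
(** Composing the first coordinate with d gives a homomorphism from H(h) to
    H(f). Pulling a Schrödinger representation back along it stays irreducible,
    even when d is not onto, because the centre of H(f) acts by scalars.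
    Non-degeneracy of f reduces to that of h: by (C1) and a cardinality count on
    the free module A, every R-linear functional on A is b |-> d (a b) for a
    unique a, so an R-linear functional on V lifts through d to an A-linear
    one. *)
Require Import Defs.
From HB Require Import structures.
From mathcomp Require Import all_boot all_order all_algebra all_fingroup.
From mathcomp Require Import mxrepresentation complex reals.

Set Implicit Arguments.
Unset Strict Implicit.
Unset Printing Implicit Defensive.

Import GRing.Theory.
Local Open Scope ring_scope.
Local Open Scope complex_scope.

Section PullBack.

Variables (M N V : finZmodType) (d : {additive M -> N}) (h : biadditive V M).
Let f := biadd_comp d h.

Definition heis_push (z : heis h) : heis f := (d z.1, z.2).

Lemma heis_pushM : {morph heis_push : x y / (x * y)%g}.
Proof.
by move=> [a u] [b v]; congr (_, _); rewrite /= /biadd_comp_fun !raddfD.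
Qed.

Lemma heis_push1 : heis_push 1%g = 1%g.
Proof. by congr (_, _); rewrite /= raddf0. Qed.

Lemma sub_isometry_set_comp : isometry_set h \subset isometry_set f.
Proof.
apply/subsetP=> g; rewrite !inE => /andP[gD /'forall_'forall_eqP gh].
by rewrite gD; apply/'forall_'forall_eqP => u v; rewrite /= /biadd_comp_fun gh.
Qed.

Variable C : fieldType.

Section Repr.

Variables (n : nat) (S : mx_representation C [set: heis f] n).

Definition pull_mx (z : heis h) : 'M[C]_n := S (heis_push z).

Lemma pull_mx_repr : mx_repr [set: heis h] pull_mx.
Proof.
split=> [|x y _ _]; first by rewrite /pull_mx heis_push1 repr_mx1.
by rewrite /pull_mx heis_pushM repr_mxM ?inE.
Qed.

Definition pull_repr := MxRepresentation pull_mx_repr.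

End Repr.

Variable theta : lin_char N C.

Lemma schrodinger_pull n (S : mx_representation C [set: heis f] n) :
  schrodinger theta S -> schrodinger (lin_char_comp d theta) (pull_repr S).
Proof.
case=> S_irr S_scal S_sim; split=> [|r|g Gg].
- have /mx_irrP[n_gt0 S_simple] := S_irr.
  apply/mx_irrP; split=> // U U_mod U_n0.
  apply: S_simple U_n0; apply/mxmoduleP => -[r v] _.
  (* Every element of H(f) is a central one, acting by a scalar, times an element in the image of
     [heis_push], so a subspace stable under the pull-back is stable under [S]. *)
  have ->: ((r, v) : heis f) = (((r, 0) : heis f) * heis_push (0%R, v))%g.
    by congr (_, _); rewrite /= /biadd_comp_fun ?biadd0l ?raddf0 ?addr0 ?add0r.
  rewrite repr_mxM ?inE // S_scal mul_scalar_mx -scalemxAr scalemx_sub //.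
  by have /mxmoduleP/(_ (0, v)) := U_mod; apply; rewrite inE.
- exact: S_scal.
(* An isometry of [h] is one of [f], and [heis_push] commutes with its action, so the intertwiner
   [B] for [S] also works for the pull-back. *)
- have [B _ B_free eqB] := S_sim g (subsetP sub_isometry_set_comp g Gg).
  by exists B => // z _; exact: (eqB (heis_push z) (in_setT _)).
Qed.

(** The operators [W g] are kept: their relation with [S] at [heis_push z] is the one required with
    [pull_repr S] at [z]. *)
Lemma weil_rep_pull (Gamma Delta : {group {perm V}}) n (W : {perm V} -> 'M[C]_n) :
  Delta \subset Gamma -> Delta \subset isometry_set h ->
  weil_rep f theta Gamma W -> weil_rep h (lin_char_comp d theta) Delta W.
Proof.
move=> /subsetP sDG sDh [_ [W1 WM] [S S_sch WS]]; split=> //.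
  by split=> // g g' /sDG Gg /sDG Gg'; apply: WM.
exists (pull_repr S); first exact: schrodinger_pull.
by move=> g /sDG Gg z; apply: WS.
Qed.

End PullBack.

Lemma linear_form_scale (R : finComNzRingType) (A : finAlgType R)
    (d : {linear A -> R^o}) r a : d (r *: a) = r * d a :> R.
Proof. exact: linearZ_LR. Qed.

(** The image under [d] of a right ideal in the kernel is an ideal of R in the kernel of [lam],
    hence zero. As the right ideal contains every [a * b] with [a], non-degeneracy of [d] kills
    [a]. *)
Lemma primitive_comp (R : finComNzRingType) (A : finAlgType R) (C : fieldType)
    (lam : lin_char R C) (d : {linear A -> R^o}) :
  (forall a : A, (forall b : A, d (a * b) = 0) -> a = 0) ->
  primitive lam -> primitive (lin_char_comp d lam : lin_char A C).
Proof.
move=> d_nondeg lam_prim I [I0 ID IM] I1.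
pose J : {set R} := [set (d a : R) | a in I].
have JP : J = [set 0].
  apply: lam_prim => [|_ /imsetP[a Ia ->]]; last exact: I1.
  split.
  - by apply/imsetP; exists 0; rewrite ?raddf0.
  - move=> _ _ /imsetP[a Ia ->] /imsetP[b Ib ->].
    by apply/imsetP; exists (a + b); rewrite ?ID ?raddfD.
  - move=> _ t /imsetP[a Ia ->]; apply/imsetP; exists (a * t%:A).
      exact: IM.
    by rewrite -scalerAr mulr1 linear_form_scale mulrC.
apply/setP => a; rewrite !inE; apply/idP/eqP => [Ia | -> //].
apply: d_nondeg => b; apply/set1P; rewrite -JP.
by apply/imsetP; exists (a * b); rewrite ?IM.
Qed.

Lemma functional_represented (R : finComNzRingType) (s : nat)
    (A : finAlgType R) (d : {linear A -> R^o}) :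
  inhabited (Vector.axiom s A) ->
  (forall a : A, (forall b : A, d (a * b) = 0) -> a = 0) ->
  forall beta : A -> R,
    (forall a b, beta (a + b) = beta a + beta b) ->
    (forall r a, beta (r *: a) = r * beta a) ->
  exists a, forall b, d (a * b) = beta b.
Proof.
move=> [[v2r v2r_lin [r2v v2rK r2vK]]] d_nondeg beta betaD betaZ.
pose e i := r2v (delta_mx 0 i).
have v2rD a b : v2r (a + b) = v2r a + v2r b.
  by have := v2r_lin 1 a b; rewrite !scale1r.
have v2r0 : v2r 0 = 0 by apply: (addrI (v2r 0)); rewrite -v2rD !addr0.
have v2rZ r a : v2r (r *: a) = r *: v2r a.
  by have := v2r_lin r a 0; rewrite v2r0 !addr0.
have e_span b : b = \sum_i v2r b 0 i *: e i.
  apply: (can_inj v2rK); rewrite (big_morph v2r v2rD v2r0).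
  rewrite {1}(row_sum_delta (v2r b)).
  by apply: eq_bigr => i _; rewrite v2rZ /e r2vK.
(* The values of b |-> d (a b) on the basis [e] determine this functional, hence [a]. Since A and
   R^s have the same finite cardinality, [F] is then also onto. *)
pose F a : {ffun 'I_s -> R} := [ffun i => d (a * e i)].
have F_inj : injective F.
  move=> a a' /ffunP eqF; apply/eqP; rewrite -subr_eq0; apply/eqP.
  apply: d_nondeg => b; rewrite (e_span b) mulr_sumr raddf_sum big1 //= => i _.
  rewrite -scalerAr linear_form_scale mulrBl raddfB /=.
  by have := eqF i; rewrite !ffunE => ->; rewrite subrr mulr0.
have cardA : (#|{: {ffun 'I_s -> R}}| <= #|{: A}|)%N.
  rewrite card_ffun card_ord (bij_eq_card (Bijective v2rK r2vK)).
  by rewrite card_mx mul1n.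
have [G _ GK] := inj_card_bij F_inj cardA.
exists (G [ffun i => beta (e i)]) => b.
have beta0 : beta 0 = 0 by apply: (addrI (beta 0)); rewrite -betaD !addr0.
rewrite [in RHS](e_span b) (big_morph beta betaD beta0) {1}(e_span b).
rewrite mulr_sumr raddf_sum; apply: eq_bigr => i _ /=.
rewrite -scalerAr linear_form_scale betaZ; congr (_ * _).
by have /ffunP/(_ i) := GK [ffun i => beta (e i)]; rewrite !ffunE.
Qed.

Section Forms.

Variables (R : finComNzRingType) (A : finAlgType R) (V : finLmodType A^c).
Variables (h : biadditive V A) (star : A -> A) (d : {linear A -> R^o}).
Let f : biadditive V R := biadd_comp d h.

Lemma GL_set_rscaleR : GL_set (@rscale R A V) \subset GL_set (@rscaleR R A V).
Proof.
apply/subsetP=> g; rewrite !inE => /andP[-> /'forall_'forall_eqP gZ].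
by apply/'forall_'forall_eqP => u r; apply: gZ.
Qed.

Lemma unitary_sub_symplectic : unitary_group h \subset symplectic_group f.
Proof. exact: setISS (sub_isometry_set_comp d h) GL_set_rscaleR. Qed.

Hypothesis star_inv : involution star.
Hypothesis h_nondeg : nondegenerate_form (@rscale R A V) star h.

(** The scalar leaves the left argument of [h] through [star], which fixes R. *)
Lemma comp_formZl u r v : f (rscaleR u r) v = r * f u v.
Proof.
have [_ hZl _] := h_nondeg; have [_ _ _ starR] := star_inv.
by rewrite /f /= /biadd_comp_fun hZl starR -scalerAl mul1r linear_form_scale.
Qed.

Lemma comp_formZr u v r : f u (rscaleR v r) = r * f u v.
Proof.
have [h_lin _ _] := h_nondeg; have [_ hZ] := h_lin u.
by rewrite /f /= /biadd_comp_fun hZ -scalerAr mulr1 linear_form_scale.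
Qed.

Lemma comp_form_nondegenerate (s : nat) :
  inhabited (Vector.axiom s A) ->
  (forall a : A, (forall b : A, d (a * b) = 0) -> a = 0) ->
  nondegenerate_form (@rscaleR R A V) id f.
Proof.
move=> A_free d_nondeg; have [h_lin _ h_onto] := h_nondeg.
split=> [v|v c w|alpha [alphaD alphaZ]].
- by split=> [u w|u c]; [apply: biaddDr | rewrite comp_formZr mulrC].
- exact: comp_formZl.
have d_inj a a' : (forall b, d (a * b) = d (a' * b)) -> a = a'.
  move=> eqd; apply/eqP; rewrite -subr_eq0; apply/eqP; apply: d_nondeg => b.
  by rewrite mulrBl raddfB /= eqd subrr.
have repr w : exists a, forall b, d (a * b) = alpha (rscale w b) :> R.
  apply: (functional_represented A_free d_nondeg) => [a b|r a].
    by rewrite -alphaD /rscale scalerDl.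
  rewrite mulrC -alphaZ /rscaleR /rscale scalerA; congr (alpha (_ *: w)).
  (* The product of [A^c] reverses factors: scaling by [a], then by [r%:A], is scaling by
     [a * r%:A]. *)
  by rewrite [RHS](_ : _ = a * r%:A) // -scalerAr mulr1.
(* A boolean form of [repr], possible because A is finite, so that [xchoose] turns the witnesses
   into a function of [w]. *)
have exA w : exists a, [forall b, d (a * b) == alpha (rscale w b) :> R].
  by have [a Ha] := repr w; exists a; apply/forallP=> b; rewrite Ha.
pose lift w := xchoose (exA w).
have liftP w b : d (lift w * b) = alpha (rscale w b) :> R.
  by have /forallP/(_ b)/eqP := xchooseP (exA w).
have rscale1 w : rscale w 1 = w by apply: scale1r.
have lift_lin : right_linear (@rscale R A V) lift.
  (* For scalars, d (lift (u c) b) and d (lift u c b) both equal alpha (u c b). *)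
  split=> [u v|u c]; apply: d_inj => b.
    by rewrite mulrDl raddfD /= !liftP /rscale scalerDr alphaD.
  by rewrite -mulrA !liftP /rscale scalerA.
have [v [hv v_uniq]] := h_onto _ lift_lin.
exists v; split=> [w|v' fv'].
  by rewrite /f /= /biadd_comp_fun hv -[lift w]mulr1 liftP rscale1.
(* Evaluating [f v'] at all multiples w b, and not only at w, recovers [h v' w] as [lift w]. *)
apply: v_uniq => w; apply: d_inj => b.
have [_ hZ] := h_lin v'.
by rewrite liftP -fv' /f /= /biadd_comp_fun hZ.
Qed.

(** Hermitian symmetry turns the condition on [d] at [h v v] into 2 f(v,v) = 0, and 2 can be
    cancelled in odd characteristic. *)
Lemma comp_form_alternating (p : nat) (eps : R) :
  p \in [pchar R] -> odd p ->
  (forall u v, h v u = eps *: star (h u v)) ->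
  (forall a : A, d (a + eps *: star a) = 0) ->
  alternating_bilinear f.
Proof.
move=> R_char p_odd h_herm d_skew; split=> [||v].
- exact: comp_formZl.
- exact: comp_formZr.
have f2 : f v v *+ 2 = 0.
  by have := d_skew (h v v); rewrite -h_herm raddfD.
have := mulrn_pchar R_char (f v v).
(* With p = 1 + 2k, the vanishing multiple p f(v,v) reduces to f(v,v). *)
by rewrite -(odd_double_half p) p_odd -mul2n mulrnDr mulrnA f2 mul0rn addr0.
Qed.

End Forms.

Theorem theorem3p2 (K : realType) (p : nat) (R : finComNzRingType)
    (R_local : local_ring R) (R_principal : principal_ring R)
    (R_char : p \in [pchar R]) (p_odd : odd p)
    (s : nat) (A : finAlgType R) (A_free : inhabited (Vector.axiom s A))
    (star : A -> A) (star_inv : involution star)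
    (m : nat) (V : finLmodType A^c) (V_free : inhabited (Vector.axiom m V))
    (V_neq0 : exists v : V, v != 0)
    (eps : R) (eps_pm1 : eps = 1 \/ eps = -1)
    (h : biadditive V A) (h_herm : hermitian_form star eps h)
    (h_nondeg : nondegenerate_form (@rscale R A V) star h)
    (lam : lin_char R K[i]) (lam_prim : primitive lam)
    (d : {linear A -> R^o})
    (C1 : forall a : A, (forall b : A, d (a * b) = 0) -> a = 0)
    (C2 : forall a : A, d (a + eps *: star a) = 0) :
  let mu : lin_char A K[i] := lin_char_comp d lam in
  let f : biadditive V R := biadd_comp d h in
  [/\ alternating_bilinear f,
      nondegenerate_form (@rscaleR R A V) id f,
      unitary_group h \subset symplectic_group f,
      primitive mu
    & forall (n : nat) (W : {perm V} -> 'M[K[i]]_n),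
        weil_rep f lam (symplectic_group f) W ->
        weil_rep h mu (unitary_group h) W].
Proof.
move=> mu f; have [_ h_sym] := h_herm.
have sUSp : unitary_group h \subset symplectic_group f.
  exact: unitary_sub_symplectic.
split=> //.
- exact: (comp_form_alternating star_inv h_nondeg R_char p_odd h_sym C2).
- exact: (comp_form_nondegenerate star_inv h_nondeg A_free C1).
- exact: primitive_comp.
- by move=> n W; apply: weil_rep_pull => //; apply: subsetIl.
Qed.
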